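(* Let $n\ge 1$, $k=2^n-1$, $\mathbf{b}\in\mathbb{R}^k$, and let $\mathbf{Q}$ be a real $q\times k$ matrix. The inequality $\mathbf{b}^{\top}\mathbf{s}\ge 0$ is a von-Neumann-type inequality under the constraints $\mathbf{Q}\mathbf{s}=\mathbf{0}$ if and only if $$\min_{\mathbf{s}\in\mathbb{R}^{k}}\ \mathbf{b}^{\top}\mathbf{s}\quad\text{subject to}\quad \mathbf{G}\mathbf{s}\ge \mathbf{0}\ \text{ and }\ \mathbf{Q}\mathbf{s}=\mathbf{0}$$ is equal to $0$.
   Context: Let $N_n=\{1,\dots,n\}$ and $k=2^n-1$. The entropic space is $\mathbb{R}^k$, with coordinates indexed by the nonempty subsets $I\subseteq N_n$; the coordinate of $\mathbf{s}$ at $I$ is written $S(I)$, and $S(\emptyset)=0$ by convention. (For an $n$-party quantum state, $S(I)$ stands for the von Neumann entropy of the marginal on the parties in $I$.) Vector inequalities are componentwise. The basic inequalities are all instances, for nonempty $I,J\subseteq N_n$, of strong sub-additivity $S(I)+S(J)\ge S(I\cup J)+S(I\cap J)$ and weak monotonicity $S(I)+S(J)\ge S(I\setminus J)+S(J\setminus I)$. The von-Neumann cone $\Gamma_n\subset\mathbb{R}^k$ is the set of all $\mathbf{s}\in\mathbb{R}^k$ satisfying all basic inequalities. The elemental inequalities are: (i) $S(I)+S(J)-S(I\cup J)-S(I\cap J)\ge 0$ for $I,J\subseteq N_n$ with $I\setminus J=\{i\}$, $J\setminus I=\{j\}$ and $j>i$; (ii) $S(I)+S(J)-S(I\setminus J)-S(J\setminus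 I)\ge 0$ for $I,J\subseteq N_n$ with $I\cap J=\{l\}$, $I\cup J=N_n$ and $l+1\in I$ (where $l+1$ is read cyclically, i.e. $n+1$ means $1$). $\mathbf{G}$ is the real coefficient matrix with $k$ columns whose rows are the coefficient vectors of the elemental inequalities, so that these inequalities read $\mathbf{G}\mathbf{s}\ge\mathbf{0}$. By a known result of Pippenger, the elemental inequalities generate all basic inequalities, so $\Gamma_n=\{\mathbf{s}\in\mathbb{R}^k:\mathbf{G}\mathbf{s}\ge\mathbf{0}\}$. Each row of $\mathbf{Q}$ represents one linear constraint on the marginal entropies. The inequality $\mathbf{b}^{\top}\mathbf{s}\ge 0$ is called von-Neumann-type under the constraints $\mathbf{Q}\mathbf{s}=\mathbf{0}$ if $\Gamma_n\cap\{\mathbf{s}\in\mathbb{R}^k:\mathbf{Q}\mathbf{s}=\mathbf{0}\}\subset\{\mathbf{s}\in\mathbb{R}^k:\mathbf{b}^{\top}\mathbf{s}\ge 0\}$. *)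

(* Defs.v *)
From mathcomp Require Import classical_sets reals.
(* Required after classical_sets, so that set0, setT, ... are the finset ones;
   classical sets are written with %classic. *)
From mathcomp Require Import all_boot all_order all_algebra.

Set Implicit Arguments.
Unset Strict Implicit.
Unset Printing Implicit Defensive.
Import Order.TTheory GRing.Theory Num.Theory.
Local Open Scope ring_scope.

(* The parties are 0, ..., n - 1 (that is, 'I_n) instead of 1, ..., n. *)

Lemma card_nonempty (n : nat) :
  #|[set~ set0 : {set 'I_n}]| = (2 ^ n - 1)%N.
Proof. by rewrite cardsC1 subn1 -cardsT -powersetT card_powerset cardsT card_ord. Qed.

(* A bijection from the coordinate indices to the nonempty sets of parties;
   which bijection it is plays no role. *)
Definition party_set (n : nat) (c : 'I_(2 ^ n - 1)) : {set 'I_n} :=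
  enum_val (cast_ord (esym (card_nonempty n)) c).

(* Coefficient row of s |-> S(I); it is zero for I = set0, as S(set0) = 0. *)
Definition Srow (R : realType) (n : nat) (I : {set 'I_n}) :
    'rV[R]_(2 ^ n - 1) :=
  \row_c (party_set c == I)%:R.

(* S(I), with S(set0) = 0 (no c has party_set c = set0). *)
Definition ent (R : realType) (n : nat) (s : 'cV[R]_(2 ^ n - 1))
    (I : {set 'I_n}) : R :=
  if [pick c | party_set c == I] is Some c then s c 0 else 0.

Definition Gamma (R : realType) (n : nat) : set 'cV[R]_(2 ^ n - 1) :=
  [set s | forall I J : {set 'I_n}, I != set0 -> J != set0 ->
     ent s I + ent s J >= ent s (I :|: J) + ent s (I :&: J) /\
     ent s I + ent s J >= ent s (I :\: J) + ent s (J :\: I)]%classic.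

Arguments Gamma : clear implicits.

(* Pairs (I, J) indexing the elemental inequalities of each kind. *)
Definition elemental_ssa (n : nat) : {set {set 'I_n} * {set 'I_n}} :=
  [set p | [exists i : 'I_n, exists j : 'I_n,
     [&& p.1 :\: p.2 == [set i], p.2 :\: p.1 == [set j] & (i < j)%N]]].

(* ordS is the cyclic successor on 'I_n. *)
Definition elemental_wm (n : nat) : {set {set 'I_n} * {set 'I_n}} :=
  [set p | [exists l : 'I_n,
     [&& p.1 :&: p.2 == [set l], p.1 :|: p.2 == setT & ordS l \in p.1]]].

Definition ssa_row (R : realType) (n : nat) (p : {set 'I_n} * {set 'I_n}) :
    'rV[R]_(2 ^ n - 1) :=
  Srow R p.1 + Srow R p.2 - Srow R (p.1 :|: p.2) - Srow R (p.1 :&: p.2).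

Definition wm_row (R : realType) (n : nat) (p : {set 'I_n} * {set 'I_n}) :
    'rV[R]_(2 ^ n - 1) :=
  Srow R p.1 + Srow R p.2 - Srow R (p.1 :\: p.2) - Srow R (p.2 :\: p.1).

Definition G (R : realType) (n : nat) :
    'M[R]_(#|elemental_ssa n| + #|elemental_wm n|, 2 ^ n - 1) :=
  col_mx (\matrix_(r < #|elemental_ssa n|) ssa_row R (enum_val r))
         (\matrix_(r < #|elemental_wm n|) wm_row R (enum_val r)).

Definition ge0v (R : realType) (m : nat) (v : 'cV[R]_m) : Prop :=
  forall i, 0 <= v i 0.

Definition von_Neumann_type (R : realType) (n q : nat)
    (Q : 'M[R]_(q, 2 ^ n - 1)) (b : 'cV[R]_(2 ^ n - 1)) : Prop :=
  (Gamma R n `&` [set s | Q *m s = 0] `<=` [set s | 0 <= (b^T *m s) 0 0])%classic.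

Definition is_minimum (R : realType) (A : set R) (m : R) : Prop :=
  A m /\ lbound A m.

Lemma party_set_inj (n : nat) : injective (@party_set n).
Proof. by move=> c d /enum_val_inj /cast_ord_inj. Qed.

Lemma party_set_neq0 (n : nat) (c : 'I_(2 ^ n - 1)) : party_set c != set0.
Proof. by have := enum_valP (cast_ord (esym (card_nonempty n)) c); rewrite !inE. Qed.

Lemma ent_set0 (R : realType) (n : nat) (s : 'cV[R]_(2 ^ n - 1)) : ent s set0 = 0.
Proof. by rewrite /ent; case: pickP => // c; rewrite (negPf (party_set_neq0 c)). Qed.

Lemma ent_party_set (R : realType) (n : nat) (s : 'cV[R]_(2 ^ n - 1)) c :
  ent s (party_set c) = s c 0.
Proof.
rewrite /ent; case: pickP => [d /eqP /party_set_inj -> // | /(_ c)].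
by rewrite eqxx.
Qed.

Lemma Srow_mul (R : realType) (n : nat) (s : 'cV[R]_(2 ^ n - 1)) I :
  (Srow R I *m s) 0 0 = ent s I.
Proof.
rewrite mxE /ent; case: pickP => [c /eqP <- | noI].
  rewrite (bigD1 c) //= mxE eqxx mul1r big1 ?addr0 // => d ned.
  by rewrite mxE (inj_eq (@party_set_inj n)) (negPf ned) mul0r.
by rewrite big1 // => d _; rewrite mxE noI mul0r.
Qed.

Lemma ge0v_G (R : realType) (n : nat) (s : 'cV[R]_(2 ^ n - 1)) :
  ge0v (G R n *m s) <->
  (forall I J, (I, J) \in elemental_ssa n ->
     0 <= ent s I + ent s J - ent s (I :|: J) - ent s (I :&: J)) /\
  (forall I J, (I, J) \in elemental_wm n ->
     0 <= ent s I + ent s J - ent s (I :\: J) - ent s (J :\: I)).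
Proof.
have rowE m (A : 'M[R]_(m, 2 ^ n - 1)) r : (A *m s) r 0 = (row r A *m s) 0 0.
  by rewrite -row_mul [RHS]mxE.
have ssaE p : (ssa_row R p *m s) 0 0 =
    ent s p.1 + ent s p.2 - ent s (p.1 :|: p.2) - ent s (p.1 :&: p.2).
  by rewrite /ssa_row !mulmxDl !mulNmx -!Srow_mul !mxE.
have wmE p : (wm_row R p *m s) 0 0 =
    ent s p.1 + ent s p.2 - ent s (p.1 :\: p.2) - ent s (p.2 :\: p.1).
  by rewrite /wm_row !mulmxDl !mulNmx -!Srow_mul !mxE.
rewrite /ge0v /G mul_col_mx; split=> [H | [H1 H2] r].
  split=> I J IJ.
    have := H (lshift _ (enum_rank_in IJ (I, J))).
    by rewrite col_mxEu rowE rowK ssaE enum_rankK_in.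
  have := H (rshift _ (enum_rank_in IJ (I, J))).
  by rewrite col_mxEd rowE rowK wmE enum_rankK_in.
case: (splitP r) => j rj.
  have ->: r = lshift _ j by apply: val_inj.
  rewrite col_mxEu rowE rowK ssaE; apply: H1.
  by rewrite -surjective_pairing enum_valP.
have ->: r = rshift _ j by apply: val_inj.
rewrite col_mxEd rowE rowK wmE; apply: H2.
by rewrite -surjective_pairing enum_valP.
Qed.

(* Main.v *)
Require Import Defs.
From mathcomp Require Import all_boot all_order all_algebra.
From mathcomp Require Import classical_sets reals.
From mathcomp Require Import finset lra.
Import Order.TTheory GRing.Theory Num.Theory.
Local Open Scope ring_scope.

(* Everything reduces to Pippenger's theorem that Gamma_n = {s | G s >= 0}:
   the feasible set then contains s = 0, so its infimum is 0 exactly when b^T s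
   is nonnegative on it.  With S(K|A) = S(KA) - S(A), the elemental inequalities
   (i) say that S(i|X) >= S(i|Xj), so S(i|X) decreases in X; adding the elements
   of I \ J one at a time gives strong sub-additivity.  Weak monotonicity reads
   S(K|A) + S(K|B) >= 0 for disjoint K, A, B.  The chain rule, run through
   K = {l_1, ..., l_m} in opposite orders in the two terms, reduces it to
   S(l|A) + S(l|B) >= 0 with A, B disjoint, and S(l|B) decreases when B is
   enlarged to the complement of A + l, which is the elemental case (ii). *)

Lemma marginal_antitone {T : finType} {R : realDomainType} {S : {set T} -> R} :
  (forall (X : {set T}) i j, i != j -> i \notin X -> j \notin X ->
     S (i |: (j |: X)) + S X <= S (i |: X) + S (j |: X)) ->
  forall i (X Y : {set T}), X \subset Y -> i \notin Y ->
    S (i |: Y) + S X <= S (i |: X) + S Y.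
Proof.
move=> loc i X Y; elim: {Y}_.+1 {-2}Y (ltnSn #|Y|) => // m IH Y ltYm sXY iY.
have [-> // | neXY] := eqVneq X Y.
have /properP[_ [j jY jX]] : X \proper Y by rewrite properEneq neXY.
have iYj : i \notin Y :\ j by rewrite !inE (negPf iY) andbF.
have nij : i != j by apply: contraNneq iY => ->.
have ltYj : (#|Y :\ j| < m)%N by move: ltYm; rewrite (cardsD1 j) jY.
have sXYj : X \subset Y :\ j by rewrite subsetD1 sXY.
(* At [Y :\ j] the hypothesis reads S(i|Y) <= S(i|Y - j); induction gives S(i|Y - j) <= S(i|X). *)
have := loc _ _ _ nij iYj (negbT (setD11 j Y)).
have := IH _ ltYj sXYj iYj.
by rewrite setD1K //; lra.
Qed.

Lemma local_submodular {T : finType} {R : realDomainType} {S : {set T} -> R} :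
  (forall (X : {set T}) i j, i != j -> i \notin X -> j \notin X ->
     S (i |: (j |: X)) + S X <= S (i |: X) + S (j |: X)) ->
  forall I J : {set T}, S (I :|: J) + S (I :&: J) <= S I + S J.
Proof.
move=> loc I J; elim: {I}_.+1 {-2}I (ltnSn #|I|) => // m IH I ltIm.
have [sIJ | /subsetPn[i iI iJ]] := boolP (I \subset J).
  by rewrite (setUidPr sIJ) (setIidPl sIJ) addrC.
have ltIi : (#|I :\ i| < m)%N by move: ltIm; rewrite (cardsD1 i) iI.
have iU : i \notin I :\ i :|: J by rewrite !inE eqxx (negPf iJ).
(* Putting [i] back leaves [I :&: J] unchanged, as [i] is not in [J], and raises S(I) by at least as
   much as S(I + J). *)
have := marginal_antitone loc _ _ _ (subsetUl (I :\ i) J) iU.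
have := IH _ ltIi.
rewrite setUA setD1K //.
have -> : (I :\ i) :&: J = I :&: J.
  by apply/setP=> x; rewrite !inE; case: eqP => //= ->; rewrite (negPf iJ) andbF.
by lra.
Qed.

Lemma local_weakly_monotone {T : finType} {R : realDomainType}
    {S : {set T} -> R} :
  (forall I J : {set T}, S (I :|: J) + S (I :&: J) <= S I + S J) ->
  (forall (A : {set T}) l, l \notin A ->
     S A + S (~: (l |: A)) <= S (l |: A) + S (~: A)) ->
  forall I J : {set T}, S (I :\: J) + S (J :\: I) <= S I + S J.
Proof.
move=> ssa loc I J; elim: {J}_.+1 {-2}J (ltnSn #|J|) => // m IH J ltJm.
have [IJ0 | [l]] := set_0Vmem (I :&: J).
  have dIJ : [disjoint I & J] by rewrite -setI_eq0 IJ0.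
  by rewrite (setDidPl dIJ) (setDidPl _) // disjoint_sym.
rewrite inE => /andP[lI lJ].
have ltJl : (#|J :\ l| < m)%N by move: ltJm; rewrite (cardsD1 l) lJ.
have lA : l \notin I :\: J by rewrite inE lJ.
(* Write A for [I :\: J]. Strong sub-additivity gives S(l|~(A + l)) <= S(l|J - l), [loc] gives
   S(l|A) + S(l|~(A + l)) >= 0, and the induction hypothesis is for [I] and [J :\ l]. In the sum of
   the three only the goal survives. *)
have := ssa J (~: (l |: (I :\: J))).
have -> : J :|: ~: (l |: (I :\: J)) = ~: (I :\: J).
  apply/setP=> x; rewrite !inE; case: eqP => [-> | _]; rewrite ?lJ //=.
  by case: (x \in J).
have -> : J :&: ~: (l |: (I :\: J)) = J :\ l.
  by apply/setP=> x; rewrite !inE; case: (x \in J); case: eqP.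
have := loc _ _ lA.
have := IH _ ltJl.
have -> : I :\: (J :\ l) = l |: (I :\: J).
  by apply/setP=> x; rewrite !inE; case: eqP => //= ->; rewrite lI.
have -> : J :\ l :\: I = J :\: I.
  by apply/setP=> x; rewrite !inE; case: eqP => //= ->; rewrite lI.
by lra.
Qed.

Lemma Gamma_elemental (R : realType) (n : nat) (s : 'cV[R]_(2 ^ n - 1)) :
  Gamma R n s <-> ge0v (G R n *m s).
Proof.
rewrite ge0v_G; split=> [Gs | [ssa wm]].
  (* Elemental inequalities are basic: the elements i and j, or l, make both sets nonempty. *)
  split=> I J; rewrite inE /=.
    case/existsP=> i /existsP[j /and3P[/eqP Ii /eqP Jj _]].
    have /Gs : I != set0.
      by apply/set0Pn; exists i; have := set11 i; rewrite -Ii inE => /andP[].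
    have /[swap]/[apply] : J != set0.
      by apply/set0Pn; exists j; have := set11 j; rewrite -Jj inE => /andP[].
    by case=> + _; lra.
  case/existsP=> l /and3P[/eqP IJ _ _].
  have : l \in I :&: J by rewrite IJ set11.
  rewrite inE => /andP[lI lJ].
  have /Gs : I != set0 by apply/set0Pn; exists l.
  have /[swap]/[apply] : J != set0 by apply/set0Pn; exists l.
  by case=> _; lra.
have sub : forall I J : {set 'I_n},
    ent s (I :|: J) + ent s (I :&: J) <= ent s I + ent s J.
  apply: local_submodular => X i j.
  (* The elemental pairs have i < j, but the inequality is symmetric in i and j. *)
  wlog lt_ij : i j / (i < j)%N => [IH nij iX jX | nij iX jX].
    have := nij; rewrite neq_ltn => /orP[/IH -> // | /IH].
    by rewrite eq_sym setUCA [leRHS]addrC; apply.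
  have /ssa : (i |: X, j |: X) \in elemental_ssa n.
    rewrite inE; apply/existsP; exists i; apply/existsP; exists j => /=.
    rewrite lt_ij andbT; apply/andP; split; apply/eqP/setP=> x; rewrite !inE.
      have [-> | _] := eqVneq x i; first by rewrite (negPf nij) (negPf iX).
      by case: (x \in X); rewrite ?orbT ?andbF.
    have [-> | _] := eqVneq x j; first by rewrite eq_sym (negPf nij) (negPf jX).
    by case: (x \in X); rewrite ?orbT ?andbF.
  rewrite setUACA setUid -setUA -setUIl.
  have -> : [set i] :&: [set j] = set0.
    by apply/setP=> x; rewrite !inE; case: eqP => // ->; rewrite (negPf nij).
  by rewrite set0U; lra.
move=> I J _ _; split; first exact: sub.
apply: local_weakly_monotone sub _ I J => A l lA.
have IE : (l |: A) :\: ~: A = A.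
  by apply/setP=> x; rewrite !inE; case: (x \in A); rewrite ?orbT.
have JE : ~: A :\: (l |: A) = ~: (l |: A).
  by apply/setP=> x; rewrite !inE; case: (x \in A); rewrite ?orbT ?andbT.
have IJI : (l |: A) :&: ~: A = [set l].
  by apply/setP=> x; rewrite !inE; case: eqP => [-> | _] //=; rewrite andbN.
have IJU : (l |: A) :|: ~: A = setT.
  by apply/setP=> x; rewrite !inE -orbA orbN orbT.
(* Elemental pairs of kind (ii) have [ordS l] in their first set, which decides the order of
   [l |: A] and [~: A]. *)
have [nextA | nextA] := boolP (ordS l \in A).
  have : (l |: A, ~: A) \in elemental_wm n.
    rewrite inE; apply/existsP; exists l => /=.
    by rewrite IJI IJU !inE nextA orbT !eqxx.
  by move/wm; rewrite IE JE; lra.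
have : (~: A, l |: A) \in elemental_wm n.
  rewrite inE; apply/existsP; exists l => /=.
  by rewrite (setIC (~: A)) (setUC (~: A)) IJI IJU !inE nextA !eqxx.
by move/wm; rewrite IE JE; lra.
Qed.

Theorem mainTheorem3 (R : realType) (n : nat) (n_ge1 : (1 <= n)%N) (q : nat)
    (b : 'cV[R]_(2 ^ n - 1)) (Q : 'M[R]_(q, 2 ^ n - 1)) :
  von_Neumann_type Q b <->
  is_minimum
    [set (b^T *m s) 0 0 | s in [set s | ge0v (G R n *m s) /\ Q *m s = 0]]%classic
    0.
Proof.
split=> [vN | [_ lb0] s [/Gamma_elemental Gs Qs]]; last by apply: lb0; exists s.
split; last by move=> _ [s [/Gamma_elemental Gs Qs] <-]; apply: vN.
(* A minimum must be attained; the zero vector does it for every [Q] and [b]. *)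
exists 0; last by rewrite mulmx0 mxE.
by split=> [i|]; rewrite mulmx0 ?mxE.
Qed.
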